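(* Let $X\subset Q$ be a zero-dimensional scheme with $\Delta M_X$ of size $(a,b)$. Let $P=R_h\cap C_k\in X$ for some $h\in\{0,\dots,a\}$ and $k\in\{0,\dots,b\}$ be such that $m_X(P)=1$, and let $p+1=\#(X\cap R_h)$ and $q+1=\#(X\cap C_k)$. Suppose that one of the following conditions holds: 1. $p=b$; 2. $q=a$; 3. $p<b$, $q<a$ and $\Delta M_X^{(i,j)}=0$ for any $(i,j)\ge(q+1,p+1)$. Then there exists a separator for $P\in X$ in degree $(q,p)$.
   Context: Let $k$ be an algebraically closed field, $Q=\mathbb P^1_k\times\mathbb P^1_k$, and $S=\bigoplus_{i,j\ge 0}H^0(Q,\mathcal O_Q(i,j))$ the bigraded coordinate ring. A $(1,0)$-line (resp. $(0,1)$-line) is the zero locus of a nonzero form of bidegree $(1,0)$ (resp. $(0,1)$). For a zero-dimensional scheme $X\subset Q$ let $I(X)\subset S$ be its saturated ideal; write $I(X)=\bigcap_{P'\in X}J_{P'}$ with $\sqrt{J_{P'}}=I_{P'}$, where $I_{P'}$ is the homogeneous ideal of the point $P'$. The Hilbert matrix of $X$ is $M_X^{(i,j)}=M_X(i,j)=\dim_k(S/I(X))_{i,j}$ ($=0$ if $i<0$ or $j<0$), and its first difference is $\Delta M_X^{(i,j)}=M_X(i,j)-M_X(i-1,j)-M_X(i,j-1)+M_X(i-1,j-1)$. Put $a=\min\{i: I(X)_{i,0}\neq0\}-1$, $b=\min\{j: I(X)_{0,j}\ne0\}-1$; then $\Delta M_X$ is said to be of size $(a,b)$. $R_0,\dots,R_a$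 and $C_0,\dots,C_b$ denote, respectively, the $(1,0)$-lines and the $(0,1)$-lines containing $X$, each of them containing at least one point of $X$. For a line $L$ defined by a form $l$, $\#(X\cap L)$ denotes the degree of the scheme defined by the saturation of $(I(X),l)$ (the number of points of $X$ on $L$). $m_X(P)$ is the length of $\mathcal O_{X,P}$. If $m_X(P)=1$, a separator for $P\in X$ in degree $(q,p)$ is a form $f\in S$ of bidegree $(q,p)$ with $f(P)\neq0$ and $f\in\bigcap_{P'\in X\setminus\{P\}}J_{P'}$. $(i_1,j_1)\ge(i_2,j_2)$ means $i_1\ge i_2$ and $j_1\ge j_2$. *)

(* Defs.v *)
From HB Require Import structures.
From mathcomp Require Import all_boot all_order all_algebra.
From mathcomp Require Import boolp classical_sets cardinality.
From mathcomp Require Import mpoly.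

Set Implicit Arguments.
Unset Strict Implicit.
Unset Printing Implicit Defensive.

Import GRing.Theory.
Local Open Scope classical_set_scope.
Local Open Scope ring_scope.

(* S = K[x0, x1, y0, y1]; the variables 0, 1 are x0, x1 (bidegree (1,0)) and
   2, 3 are y0, y1 (bidegree (0,1)). *)
Notation bipoly K := {mpoly K[4]}.

Definition xdeg (m : 'X_{1..4}) : nat := (\sum_(t < 4 | (t < 2)%N) m t)%N.
Definition ydeg (m : 'X_{1..4}) : nat := (\sum_(t < 4 | (2 <= t)%N) m t)%N.

Fact xdeg0 : xdeg 0%MM = 0%N.
Proof. by rewrite /xdeg big1 // => t _; rewrite mnm0E. Qed.

Fact xdegD : {morph xdeg : m1 m2 / (m1 + m2)%MM >-> (m1 + m2)%N}.
Proof.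
by move=> m1 m2; rewrite /xdeg -big_split /=; apply: eq_bigr => t _; rewrite mnmDE.
Qed.

Fact ydeg0 : ydeg 0%MM = 0%N.
Proof. by rewrite /ydeg big1 // => t _; rewrite mnm0E. Qed.

Fact ydegD : {morph ydeg : m1 m2 / (m1 + m2)%MM >-> (m1 + m2)%N}.
Proof.
by move=> m1 m2; rewrite /ydeg -big_split /=; apply: eq_bigr => t _; rewrite mnmDE.
Qed.

HB.instance Definition _ := isMeasure.Build 4 xdeg xdeg0 xdegD.
HB.instance Definition _ := isMeasure.Build 4 ydeg ydeg0 ydegD.

(* The zero polynomial is a form of every bidegree. *)
Definition biform (K : fieldType) (i j : nat) : set (bipoly K) :=
  [set f | (f \is i.-homog for xdeg) && (f \is j.-homog for ydeg)].

Definition is_biform (K : fieldType) : set (bipoly K) :=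
  [set f | exists i j, biform i j f].

(* P^1(K) through normalized homogeneous coordinates: [Some t] is [1 : t] and
   [None] is [0 : 1]. *)
Definition P1 (K : fieldType) : Type := option K.

Definition P1_coord (K : fieldType) (u : P1 K) : K * K :=
  if u is Some t then (1, t) else (0, 1).

(* The closed points of Q, K being algebraically closed. *)
Definition quadric (K : fieldType) : Type := (P1 K * P1 K)%type.

Definition coord (K : fieldType) (P : quadric K) : 'I_4 -> K :=
  fun t => [:: (P1_coord P.1).1; (P1_coord P.1).2;
               (P1_coord P.2).1; (P1_coord P.2).2]`_t.

(* Used only for bihomogeneous ideals and for single forms, where vanishing does
   not depend on the choice of homogeneous coordinates. *)
Definition zeros (K : fieldType) (A : set (bipoly K)) : set (quadric K) :=
  [set P | forall f, A f -> f.@[coord P] = 0].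

Section Ideals.
Variable K : fieldType.
Local Notation S := (bipoly K).
Implicit Types (I J A : set S) (P : quadric K).

Definition is_ideal I :=
  [/\ I 0, forall f g, I f -> I g -> I (f + g) & forall c f, I f -> I (c * f)].

Definition ideal_gen A : set S := \bigcap_(I in [set I | is_ideal I /\ A `<=` I]) I.

Definition bihomogeneous I := I = ideal_gen (I `&` @is_biform K).

(* I : B^oo for the irrelevant ideal B = (x0, x1) \cap (y0, y1); the power B^n
   is generated by the forms of bidegree (n, n). *)
Definition saturation I : set S :=
  [set f | exists n, forall g, biform n n g -> I (g * f)].

Definition radical I : set S := [set f | exists n, I (f ^+ n)].

Definition primary I :=
  [/\ is_ideal I, ~ I 1 & forall f g, I (f * g) -> I f \/ radical I g].

Definition point_ideal P : set S :=
  ideal_gen [set f | is_biform f /\ f.@[coord P] = 0].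

(* Closed subschemes X of Q are identified with their saturated ideals I(X);
   [zeros I] is then the set of points of X. *)
Definition zero_dim_scheme I :=
  [/\ is_ideal I, bihomogeneous I, saturation I = I & finite_set (zeros I)].

(* The J_P' are unique, the radicals I_P' being pairwise incomparable. *)
Definition primary_decomposition I (J : quadric K -> set S) :=
  (forall P, zeros I P ->
     [/\ primary (J P), bihomogeneous (J P) & radical (J P) = point_ideal P]) /\
  I = \bigcap_(P in zeros I) J P.

Definition quotient_basis I (i j n : nat) (v : 'I_n -> S) :=
  [/\ forall t, biform i j (v t),
      forall c : 'I_n -> K, I (\sum_t c t *: v t) -> forall t, c t = 0
    & forall f, biform i j f ->
        exists c : 'I_n -> K, I (f - \sum_t c t *: v t)].

(* dim_K (S/I)_{i,j}; the default value is never used, as S_{i,j} is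
   finite-dimensional. *)
Definition hilb I (i j : nat) : nat :=
  xget 0%N [set n | exists v : 'I_n -> S, quotient_basis I i j v].

Definition hilbert_matrix I (i j : int) : int :=
  match i, j with
  | Posz m, Posz n => (hilb I m n)%:Z
  | _, _ => 0
  end.

Definition Delta_hilbert I (i j : int) : int :=
  hilbert_matrix I i j - hilbert_matrix I (i - 1) j
  - hilbert_matrix I i (j - 1) + hilbert_matrix I (i - 1) (j - 1).

(* a + 1 and b + 1 are the least degrees of nonzero forms of I in x alone and in
   y alone. With a, b : nat the empty scheme (a = b = -1) is left out. *)
Definition Delta_size I (a b : nat) :=
  [/\ exists f, [/\ I f, biform a.+1 0 f & f != 0],
      forall i f, (i <= a)%N -> I f -> biform i 0 f -> f = 0,
      exists f, [/\ I f, biform 0 b.+1 f & f != 0]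
    & forall j f, (j <= b)%N -> I f -> biform 0 j f -> f = 0].

(* A zero-dimensional scheme has constant Hilbert polynomial, its degree. *)
Definition has_degree I (d : nat) :=
  exists N, forall i j, (N <= i)%N -> (N <= j)%N -> hilb I i j = d.

(* #(X \cap L) = d, where the form l defines L. *)
Definition card_on_line I (l : S) (d : nat) :=
  has_degree (saturation (ideal_gen (I `|` [set l]))) d.

(* O_{Q,P} and I O_{Q,P}, as subsets of the fraction field of S. *)
Definition local_ring P : set {fraction S} :=
  [set z | exists i j f g, [/\ biform i j f, biform i j g, g.@[coord P] != 0
                             & z = tofrac f / tofrac g]].

Definition local_ideal I P : set {fraction S} :=
  [set z | exists i j f g, [/\ I f, biform i j f, biform i j g,
                               g.@[coord P] != 0 & z = tofrac f / tofrac g]].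

Definition is_local_ideal P (N : set {fraction S}) :=
  [/\ N `<=` local_ring P, N 0, forall y z, N y -> N z -> N (y + z)
    & forall c z, local_ring P c -> N z -> N (c * z)].

(* Chains of submodules 0 = N_0 < ... < N_n = O_{X,P} of
   O_{X,P} = O_{Q,P} / I O_{Q,P}, lifted to O_{Q,P}. *)
Definition ideal_chain I P (n : nat) (N : nat -> set {fraction S}) :=
  [/\ N 0%N = local_ideal I P, N n = local_ring P,
      forall t, (t <= n)%N -> is_local_ideal P (N t)
    & forall t, (t < n)%N -> N t `<` N t.+1].

(* m_X(P) = n: the length of O_{X,P} as a module over itself. *)
Definition has_length I P (n : nat) :=
  (exists N, ideal_chain I P n N) /\
  (forall n' N, ideal_chain I P n' N -> (n' <= n)%N).

(* R_0, ..., R_a: (1,0)-lines whose union contains X as a scheme (so a line is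
   repeated when X is not reduced in the transverse direction), each meeting
   X. *)
Definition row_lines I (a : nat) (R : 'I_a.+1 -> S) :=
  [/\ forall h, biform 1 0 (R h) /\ R h != 0, I (\prod_h R h)
    & forall h, zeros I `&` zeros [set R h] !=set0].

Definition col_lines I (b : nat) (C : 'I_b.+1 -> S) :=
  [/\ forall k, biform 0 1 (C k) /\ C k != 0, I (\prod_k C k)
    & forall k, zeros I `&` zeros [set C k] !=set0].

Definition separator I (J : quadric K -> set S) P (q p : nat) (f : S) :=
  [/\ biform q p f, f.@[coord P] != 0
    & (\bigcap_(P' in zeros I `\ P) J P') f].

End Ideals.

(* Main.v *)
From Pilot Require Import Defs.
From HB Require Import structures.
From mathcomp Require Import all_boot all_order all_algebra.
From mathcomp Require Import boolp classical_sets cardinality.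
From mathcomp Require Import mpoly.
From mathcomp Require Import zify ring.
Import Pilot.Defs.

Set Implicit Arguments.
Unset Strict Implicit.
Unset Printing Implicit Defensive.

Import GRing.Theory.
Local Open Scope classical_set_scope.
Local Open Scope ring_scope.

(** Let X be the scheme, and call a pair (i, j) good when a separator of bidegree
    (i, j) exists. A pair stays good when an entry increases, since a separator
    can be multiplied by forms that do not vanish at P.

    First, (q, b) and (a, p) are always good ([separator_along_line], applied to
    each ruling in turn). Take for instance the column C, of equation c. That X meets C in degree q + 1 gives
    a form of degree q + 1 in x that is monic with respect to a general line
    l = 0 of the other ruling and that vanishes on the intersection
    ([monic_equation_on_line]). This is the situation of Nakayama's lemma: near
    C the algebra of X is finite over the ring of functions of y, and modulo c
    it is generated by the powers of x up to q, hence it is so generated before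
    reduction. Concretely, dividing by the monic form and repeating for the
    successive powers of c, a separator of high degree in x becomes, modulo the
    ideal of X, a power of l times a form of degree q in x
    ([lower_degree_along_line]); that form is again a separator, as l avoids X.
    The degree in y comes down to b because the ideal contains a form of degree
    b + 1 in y alone, which is monic with respect to a general line y = 0
    ([separator_descent]). This settles the cases p = b and q = a.

    In the third case suppose that (q, p) is not good. Moving along the
    staircase from (q, b) to (a, p) one meets a corner: (u, n + 1) and
    (u + 1, n) are good, (u, n) is not, and u >= q, n >= p. There the
    difference of the Hilbert matrix is negative ([corner_drop]), against the
    hypothesis that it vanishes. Indeed, with f and e the two separators and l, y
    general, P being a simple point gives that y e and l f are proportional
    modulo the ideal ([corner_relation]). The map (s, t) |-> l s + y t into
    the quotient in bidegree (u + 1, n + 1) is then onto, because modulo l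
    and y the forms of that bidegree reduce to multiples of y' e, for any linear
    form y' independent of y, and y' e is again proportional to l f. Its kernel
    contains, besides the pairs (y w, - l w) with w of bidegree (u, n), one pair
    with second entry e, which is not among them because (u, n) is not good.
    Counting dimensions gives the inequality ([corner_count]). *)

(** * Forms, with the two rulings treated alike *)

(** A boolean selects one of the two factors of the quadric, [false] being the
    first, so that rows and columns share one proof. *)
Definition dir_deg (s : bool) : measure 4 :=
  if s then (ydeg : measure 4) else (xdeg : measure 4).

Definition bihom (K : fieldType) (s : bool) (i j : nat) : set (bipoly K) :=
  [set f | f \is i.-homog for (dir_deg s) /\ f \is j.-homog for (dir_deg (~~ s))].

Definition var0 (s : bool) : 'I_4 := if s then inord 2 else inord 0.
Definition var1 (s : bool) : 'I_4 := if s then inord 3 else inord 1.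

Definition dir_pt (K : fieldType) (s : bool) (P : quadric K) : P1 K :=
  if s then P.2 else P.1.

Section Forms.
Variable K : fieldType.
Local Notation S := (bipoly K).
Implicit Types (s : bool) (i j : nat) (f g F : S) (P Q : quadric K) (u : P1 K).

Lemma biformE s i j f : bihom s i j f <-> if s then biform j i f else biform i j f.
Proof.
by case: s; rewrite /bihom /biform /=; split=> [[-> ->]|/andP[-> ->]].
Qed.

Lemma bihomC s i j f : bihom s i j f <-> bihom (~~ s) j i f.
Proof. by rewrite /bihom /= negbK; split=> -[]. Qed.

Lemma bihom_cast s i j i' j' f :
  bihom s i j f -> i = i' -> j = j' -> bihom s i' j' f.
Proof. by move=> hf <- <-. Qed.

Lemma bihom0 s i j : bihom s i j (0 : S).
Proof. by split; apply: rpred0. Qed.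

Lemma bihomD s i j f g : bihom s i j f -> bihom s i j g -> bihom s i j (f + g).
Proof. by move=> [? ?] [? ?]; split; apply: rpredD. Qed.

Lemma bihomZ s i j (c : K) f : bihom s i j f -> bihom s i j (c *: f).
Proof. by move=> [? ?]; split; apply: rpredZ. Qed.

Lemma bihomN s i j f : bihom s i j f -> bihom s i j (- f).
Proof. by move=> /(bihomZ (-1)); rewrite scaleN1r. Qed.

Lemma bihomB s i j f g : bihom s i j f -> bihom s i j g -> bihom s i j (f - g).
Proof. by move=> ? /bihomN; apply: bihomD. Qed.

Lemma bihom_sum s i j n (F : 'I_n -> S) :
  (forall t, bihom s i j (F t)) -> bihom s i j (\sum_t F t).
Proof.
by move=> hF; elim/big_ind: _ => // [|f g]; [apply: bihom0|apply: bihomD].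
Qed.

Lemma bihomM s i j i' j' f g :
  bihom s i j f -> bihom s i' j' g -> bihom s (i + i') (j + j') (f * g).
Proof. by move=> [? ?] [? ?]; split; apply: dhomogM. Qed.

Lemma bihom1 s : bihom s 0 0 (1 : S).
Proof. by split; apply: dhomog1. Qed.

Lemma bihomX s i j n f : bihom s i j f -> bihom s (i * n) (j * n) (f ^+ n).
Proof. by move=> [? ?]; split; apply: dhomogMn. Qed.

Lemma dir_degU s : [/\ dir_deg s U_(var0 s)%MM = 1%N, dir_deg s U_(var1 s)%MM = 1%N,
  dir_deg (~~ s) U_(var0 s)%MM = 0%N & dir_deg (~~ s) U_(var1 s)%MM = 0%N].
Proof.
case: s; split; rewrite /= /xdeg /ydeg !big_mkcond !big_ord_recl big_ord0;
  by rewrite !mnmE -!val_eqE /= !inordK.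
Qed.

Lemma dir_degE s m : dir_deg s m = (m (var0 s) + m (var1 s))%N.
Proof.
case: s; rewrite /= /xdeg /ydeg !big_mkcond !big_ord_recl big_ord0 /=
  ?addn0 ?add0n; congr (m _ + m _)%N; apply: val_inj; by rewrite /= !inordK.
Qed.

Lemma bihom_var0 s : bihom s 1 0 ('X_(var0 s) : S).
Proof. by case: (dir_degU s) => h1 h2 h3 h4; split; rewrite dhomogX ?h1 ?h3. Qed.

Lemma bihom_var1 s : bihom s 1 0 ('X_(var1 s) : S).
Proof. by case: (dir_degU s) => h1 h2 h3 h4; split; rewrite dhomogX ?h2 ?h4. Qed.

(** Every monomial of positive degree is divisible by one of the two variables;
    the first takes precedence. *)
Lemma var_split s i j F : bihom s i.+1 j F ->
  exists F0 F1, [/\ F = 'X_(var0 s) * F0 + 'X_(var1 s) * F1,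
    bihom s i j F0 & bihom s i j F1].
Proof.
move=> [hs hns].
pose T (v : 'I_4) (Q : pred 'X_{1..4}) : S :=
  \sum_(m <- msupp F | Q m) F@_m *: 'X_[(m - U_(v))%MM].
have lev (v : 'I_4) (m : 'X_{1..4}) : (0 < m v)%N -> (U_(v) <= m)%MM.
  move=> mv; apply/mnm_lepP => t; rewrite mnm1E; case: eqP => //= <-.
  by rewrite lt0n -lt0n.
have T1 v (Q : pred 'X_{1..4}) : (forall m, Q m -> (0 < m v)%N) ->
    'X_v * T v Q = \sum_(m <- msupp F | Q m) F@_m *: 'X_[m].
  move=> hQ; rewrite /T mulr_sumr; apply: eq_bigr => m /hQ mv.
  by rewrite -scalerAr -mpolyXD addmC submK ?lev.
have T2 v (Q : pred 'X_{1..4}) : (forall m, Q m -> (0 < m v)%N) ->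
    dir_deg s U_(v)%MM = 1%N -> dir_deg (~~ s) U_(v)%MM = 0%N ->
    bihom s i j (T v Q).
  move=> hQ h1 h0; split; rewrite /T big_seq_cond; apply: rpred_sum => m
    /andP[mF /hQ mv]; apply: rpredZ; rewrite dhomogX; apply/eqP.
    by have := dhomog_mf hs mF; rewrite -{1}(submK (lev _ _ mv)) mfD h1; lia.
  by have := dhomog_mf hns mF; rewrite -{1}(submK (lev _ _ mv)) mfD h0; lia.
have [h1 h2 h3 h4] := dir_degU s.
exists (T (var0 s) [pred m : 'X_{1..4} | (0 < m (var0 s))%N]).
exists (T (var1 s) [pred m : 'X_{1..4} | (m (var0 s) == 0)%N && (0 < m (var1 s))%N]).
split.
- rewrite T1 // T1; last by move=> m /andP[].
  rewrite [LHS]mpolyE [LHS](bigID [pred m : 'X_{1..4} | (0 < m (var0 s))%N]) /=; congr (_ + _).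
  rewrite big_seq_cond [RHS]big_seq_cond; apply: eq_bigl => m.
  case mF: (m \in msupp F) => //=; rewrite -eqn0Ngt.
  case: eqP => //= m0; have := dhomog_mf hs mF.
  by rewrite dir_degE m0 add0n => ->.
- by apply: T2.
- by apply: T2 => // m /andP[].
Qed.

Definition lin s u : S :=
  (P1_coord u).1 *: 'X_(var1 s) - (P1_coord u).2 *: 'X_(var0 s).

(** Completes [lin s u] to a basis of the forms of degree one. *)
Definition colin s u : S := if u is Some _ then 'X_(var0 s) else 'X_(var1 s).

Lemma bihom_lin s u : bihom s 1 0 (lin s u).
Proof. by apply: bihomB; apply: bihomZ; [apply: bihom_var1|apply: bihom_var0]. Qed.

Lemma bihom_colin s u : bihom s 1 0 (colin s u).
Proof. by case: u => [t|]; [apply: bihom_var0|apply: bihom_var1]. Qed.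

Lemma coord_var s Q : coord Q (var0 s) = (P1_coord (dir_pt s Q)).1 /\
  coord Q (var1 s) = (P1_coord (dir_pt s Q)).2.
Proof. by rewrite /coord /var0 /var1 /dir_pt; case: s; rewrite !inordK. Qed.

Lemma lin_eq0 s u Q : ((lin s u).@[coord Q] == 0) = (dir_pt s Q == u).
Proof.
rewrite /lin mevalB !mevalZ !mevalXU; have [-> ->] := coord_var s Q.
case: (dir_pt s Q) => [v|]; case: u => [w|] /=;
  by rewrite ?(mul1r, mulr1, mul0r, mulr0, subr0, sub0r, oppr_eq0, oner_eq0,
    subr_eq0) // ?eqxx // eq_sym oner_eq0.
Qed.

Lemma colin_at s Q : (colin s (dir_pt s Q)).@[coord Q] = 1.
Proof.
have [h0 h1] := coord_var s Q; rewrite /colin.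
by case e: (dir_pt s Q) h0 h1 => [v|] /= h0 h1; rewrite mevalXU.
Qed.

(** Division with remainder by a linear form: modulo [lin s u] the coordinate ring
    is a polynomial ring in [colin s u] over the forms in the other variables. *)
Lemma lin_split s u i j F : bihom s i.+1 j F ->
  exists F1 F2, [/\ F = lin s u * F1 + colin s u ^+ i.+1 * F2,
    bihom s i j F1 & bihom s 0 j F2].
Proof.
elim: i F => [|i IHi] F /var_split[A [B [-> hA hB]]].
  have {A B hA hB} [C [D [-> hC hD]]] : exists C D : S, [/\
      'X_(var0 s) * A + 'X_(var1 s) * B = lin s u * C + colin s u * D,
      bihom s 0 j C & bihom s 0 j D].
    case: u => [t|] /=; rewrite /lin /=.
      exists B, (A + t *: B); split=> //; last by apply/bihomD/bihomZ.
      by rewrite -!mul_mpolyC; ring.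
    exists (- A), B; split=> //; last exact: bihomN.
    by rewrite -!mul_mpolyC; ring.
  by exists C, D.
have {A B hA hB} [C [D [-> hC hD]]] : exists C D : S, [/\
    'X_(var0 s) * A + 'X_(var1 s) * B = lin s u * C + colin s u * D,
    bihom s i.+1 j C & bihom s i.+1 j D].
  case: u {IHi} => [t|] /=; rewrite /lin /=.
    exists B, (A + t *: B); split=> //; last by apply/bihomD/bihomZ.
    by rewrite -!mul_mpolyC; ring.
  exists (- A), B; split=> //; last exact: bihomN.
  by rewrite -!mul_mpolyC; ring.
have [D1 [D2 [-> h1 h2]]] := IHi _ hD.
exists (C + colin s u * D1), D2; split=> //; first by rewrite [colin s u ^+ i.+2]exprS; ring.
by apply: bihomD => //; apply: (bihomM (bihom_colin s u) h1).
Qed.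

Lemma bihom00 s F : bihom s 0 0 F -> F = (F@_0)%:MP.
Proof.
move=> [h1 h2]; apply/mpolyP => m; rewrite mcoeffC.
case: eqP => [->|m0]; rewrite ?mulr1 // mulr0; apply/eqP.
case: eqP => // /eqP Fm; case: m0; rewrite -mcoeff_msupp in Fm.
have := dhomog_mf h1 Fm; have := dhomog_mf h2 Fm; rewrite !dir_degE => e1 e2.
apply/mnmP => t; rewrite mnm0E; move: e1 e2.
have tE : [|| t == var0 s, t == var1 s, t == var0 (~~ s) | t == var1 (~~ s)].
  by case: s {h1 h2}; case: t => [[|[|[|[|?]]]] ht] //; rewrite -!val_eqE /= !inordK.
by case/or4P: tE => /eqP ->; lia.
Qed.

End Forms.

(** * Ideals and their homogeneous components *)

Section IdealTheory.
Variable K : fieldType.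
Local Notation S := (bipoly K).
Implicit Types (I A : set S) (f g c : S).

Section Basics.
Variables (I : set S) (idI : is_ideal I).

Lemma ideal0 : I 0. Proof. by case: idI. Qed.

Lemma idealD f g : I f -> I g -> I (f + g).
Proof. by case: idI => _ h _; apply: h. Qed.

Lemma ideal_mull f g : I g -> I (f * g).
Proof. by case: idI => _ _ h; apply: h. Qed.

Lemma ideal_mulr f g : I f -> I (f * g).
Proof. by rewrite mulrC; apply: ideal_mull. Qed.

Lemma idealZ (a : K) f : I f -> I (a *: f).
Proof. by rewrite -mul_mpolyC; apply: ideal_mull. Qed.

Lemma idealN f : I f -> I (- f).
Proof. by rewrite -mulN1r; apply: ideal_mull. Qed.

Lemma idealB f g : I f -> I g -> I (f - g).
Proof. by move=> ? /idealN; apply: idealD. Qed.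

Lemma ideal_sum n (F : 'I_n -> S) : (forall t, I (F t)) -> I (\sum_t F t).
Proof.
by move=> hF; elim/big_ind: _ => // [|f g]; [apply: ideal0|apply: idealD].
Qed.

End Basics.

Lemma ideal_gen_min A I : is_ideal I -> A `<=` I -> ideal_gen A `<=` I.
Proof. by move=> hI AI f; apply. Qed.

Lemma sub_ideal_gen A : A `<=` ideal_gen A.
Proof. by move=> f Af I [_]; apply. Qed.

Lemma ideal_genU1 I c f : is_ideal I -> ideal_gen (I `|` [set c]) f ->
  exists g h, I g /\ f = g + c * h.
Proof.
move=> idI; apply: (@ideal_gen_min _ [set f | exists g h, I g /\ f = g + c * h]).
  split=> [|x y [g [h [Ig ->]]] [g' [h' [Ig' ->]]]|d x [g [h [Ig ->]]]].
  - by exists 0, 0; rewrite mulr0 addr0; split=> //; apply: ideal0.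
  - exists (g + g'), (h + h'); split; last by ring.
    exact: idealD.
  - exists (d * g), (d * h); split; last by ring.
    exact: ideal_mull.
move=> x [Ix|->]; first by exists x, 0; rewrite mulr0 addr0.
by exists 0, 1; rewrite mulr1 add0r; split=> //; apply: ideal0.
Qed.

Lemma pihomogM (mf : measure 4) d e c f : c \is d.-homog for mf ->
  pihomog mf (d + e) (c * f) = c * pihomog mf e f.
Proof.
move=> hc.
rewrite [in LHS](pihomog_partitionE (leqnn (mmeasure mf f))) mulr_sumr raddf_sum /=.
have hterm k : pihomog mf (d + e) (c * pihomog mf k f) =
    if k == e then c * pihomog mf e f else 0.
  have hk := dhomogM hc (pihomogP mf k f).
  case: eqP => [<-|/eqP ke]; first by rewrite pihomog_dE.
  by rewrite (pihomog_ne0 _ hk) // eqn_add2l.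
under eq_bigr do rewrite hterm.
rewrite -big_mkcond /=; case: (ltnP e (mmeasure mf f)) => he.
  by rewrite (big_pred1 (Ordinal he)) // => t; rewrite -val_eqE.
rewrite big_pred0 => [|t]; last by apply/eqP => te; have := ltn_ord t; lia.
rewrite [in RHS](pihomog_partitionE (leqnn (mmeasure mf f))) raddf_sum /= big1 ?mulr0 //.
move=> t _; rewrite (@pihomog_ne0 _ _ _ t) ?pihomogP //.
by apply/eqP => te; have := ltn_ord t; lia.
Qed.

Lemma is_ideal_gen A : is_ideal (ideal_gen A).
Proof.
split=> [I [hI _]|f g hf hg I hI|c f hf I hI]; first exact: ideal0.
  by apply: idealD; [case: hI|apply: hf|apply: hg].
by apply: ideal_mull; [case: hI|apply: hf].
Qed.

(** The polynomials all of whose components lie in [I] form an ideal that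
    contains the forms of [I]. *)
Lemma bihomogeneous_proj I s d f : is_ideal I -> bihomogeneous I ->
  I f -> I (pihomog (dir_deg s) d f).
Proof.
move=> idI hI If.
suff: [set f | forall d, I (pihomog (dir_deg s) d f)] f by apply.
move: If; rewrite {1}hI; apply: ideal_gen_min.
  split=> [e|x y hx hy e|c x hx e].
  - by rewrite /= raddf0; apply: ideal0.
  - by rewrite /= raddfD; apply: idealD => //; [apply: hx|apply: hy].
  - rewrite /= [c](pihomog_partitionE (leqnn (mmeasure (dir_deg s) c))).
    rewrite mulr_suml raddf_sum; apply: ideal_sum => //= t.
    case: (leqP t e) => te; last first.
      rewrite [x](pihomog_partitionE (leqnn (mmeasure (dir_deg s) x))).
      rewrite mulr_sumr raddf_sum /= big1; first exact: ideal0.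
      move=> k _.
      rewrite (pihomog_ne0 _ (dhomogM (pihomogP _ t c) (pihomogP _ k x))) //.
      by apply/eqP; lia.
    by rewrite -(subnKC te) (pihomogM _ _ (pihomogP _ _ _)); apply: ideal_mull.
move=> x [Ix [i [j /andP[hi hj]]]] e /=.
have [k hk] : exists k, x \is k.-homog for (dir_deg s).
  by case: s; [exists j|exists i].
case: (eqVneq k e) => [<-|ke]; first by rewrite pihomog_dE.
by rewrite (pihomog_ne0 ke hk); apply: ideal0.
Qed.

Lemma pihomog_other s e i f : f \is i.-homog for (dir_deg s) ->
  pihomog (dir_deg (~~ s)) e f \is i.-homog for (dir_deg s).
Proof.
move=> /dhomogP hf; rewrite pihomogE big_seq_cond; apply: rpred_sum => m /andP[mf _].
by apply: rpredZ; rewrite dhomogX; apply/eqP/hf.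
Qed.

(** Take the component of bidegree (i, j + 1) in any splitting of [f]; both
    summands stay in their ideals. *)
Lemma ideal_genU1_form I s c i j f : is_ideal I -> bihomogeneous I ->
  bihom s 0 1 c -> bihom s i j.+1 f -> ideal_gen (I `|` [set c]) f ->
  exists h, bihom s i j h /\ I (f - c * h).
Proof.
move=> idI bhI [c0 c1] [fi fj] /(ideal_genU1 idI)[g [h [Ig ef]]].
exists (pihomog (dir_deg (~~ s)) j (pihomog (dir_deg s) i h)); split.
  by split; [apply: pihomog_other|]; apply: pihomogP.
suff -> : f - c * pihomog (dir_deg (~~ s)) j (pihomog (dir_deg s) i h) =
    pihomog (dir_deg (~~ s)) j.+1 (pihomog (dir_deg s) i g).
  by do 2!apply: bihomogeneous_proj => //.
have e0 x : pihomog (dir_deg s) i (c * x) = c * pihomog (dir_deg s) i x.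
  exact: (pihomogM i x c0).
have e1 x : pihomog (dir_deg (~~ s)) j.+1 (c * x) =
    c * pihomog (dir_deg (~~ s)) j x by exact: (pihomogM j x c1).
apply/eqP; rewrite subr_eq -e1 -e0 -!raddfD /= -ef.
by rewrite (pihomog_dE fi) (pihomog_dE fj).
Qed.

(** * Quotients in a fixed bidegree *)

Lemma left_dependence N M (A : 'M[K]_(N, M)) : (M < N)%N ->
  exists2 c : 'rV_N, c != 0 & c *m A = 0.
Proof.
move=> MN; have : kermx A != 0.
  rewrite kermx_eq0 /row_free; apply/eqP => rk.
  by have := rank_leq_col A; rewrite rk leqNgt MN.
by case/rowV0Pn => c /sub_kermxP cA c0; exists c.
Qed.

(** Two quotients are treated at once, so that dimensions can be counted in the
    direct sum of two bidegrees. *)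
Lemma ideal_dependence I N m1 m2 (v1 : 'I_m1 -> S) (v2 : 'I_m2 -> S)
    (e1 e2 : 'I_N -> S) : is_ideal I -> (m1 + m2 < N)%N ->
  (forall r, exists c : 'I_m1 -> K, I (e1 r - \sum_k c k *: v1 k)) ->
  (forall r, exists c : 'I_m2 -> K, I (e2 r - \sum_k c k *: v2 k)) ->
  exists2 d : 'rV[K]_N, d != 0 &
    I (\sum_r d 0 r *: e1 r) /\ I (\sum_r d 0 r *: e2 r).
Proof.
move=> idI mN /fin_all_exists[c1 h1] /fin_all_exists[c2 h2].
pose A := row_mx (\matrix_(r, k) c1 r k) (\matrix_(r, k) c2 r k).
have [d d0 /eqP] := left_dependence A mN.
rewrite /A mul_mx_row row_mx_eq0 => /andP[/eqP k1 /eqP k2]; exists d => //.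
have red m (v : 'I_m -> S) (e : 'I_N -> S) (c : 'I_N -> 'I_m -> K) :
    (forall r, I (e r - \sum_k c r k *: v k)) ->
    d *m \matrix_(r, k) c r k = 0 -> I (\sum_r d 0 r *: e r).
  move=> hv /matrixP dc.
  suff -> : \sum_r d 0 r *: e r = \sum_r d 0 r *: (e r - \sum_k c r k *: v k).
    by apply: ideal_sum => // r; apply: idealZ.
  under [RHS]eq_bigr do rewrite scalerBr scaler_sumr.
  rewrite sumrB [X in _ - X]exchange_big /= [X in _ - X]big1 ?subr0 // => k _.
  under eq_bigr do rewrite scalerA.
  rewrite -scaler_suml; have := dc 0 k; rewrite !mxE.
  by under eq_bigr do rewrite mxE; move=> ->; rewrite scale0r.
by split; [apply: red k1|apply: red k2].
Qed.

Lemma bihom_span s i j : exists n (v : 'I_n -> S),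
  (forall t, bihom s i j (v t)) /\
  forall f, bihom s i j f -> exists c : 'I_n -> K, f = \sum_t c t *: v t.
Proof.
elim: i s j => [|i IHi] s j; last first.
  have [n [v [hv gv]]] := IHi s j.
  exists (n + n)%N, (fun t => match split t with
    inl a => 'X_(var0 s) * v a | inr a => 'X_(var1 s) * v a end); split.
    move=> t; case: (split t) => a; have := hv a.
      by apply: (bihomM (bihom_var0 _ s)).
    by apply: (bihomM (bihom_var1 _ s)).
  move=> f /var_split[F0 [F1 [-> /gv[c0 ->] /gv[c1 ->]]]].
  exists (fun t => match split t with inl a => c0 a | inr a => c1 a end).
  rewrite big_split_ord /= !mulr_sumr; congr (_ + _); apply: eq_bigr => t _.
    by rewrite (unsplitK (inl t)) scalerAr.
  by rewrite (unsplitK (inr t)) scalerAr.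
elim: j s => [|j IHj] s; last first.
  have [n [v [hv gv]]] := IHj s.
  exists (n + n)%N, (fun t => match split t with
    inl a => 'X_(var0 (~~ s)) * v a | inr a => 'X_(var1 (~~ s)) * v a end); split.
    move=> t; apply/bihomC; case: (split t) => a; have /bihomC := hv a.
      by apply: (bihomM (bihom_var0 _ (~~ s))).
    by apply: (bihomM (bihom_var1 _ (~~ s))).
  move=> f /bihomC /var_split[F0 [F1 [-> /bihomC hF0 /bihomC hF1]]].
  rewrite negbK in hF0 hF1; have [[c0 ->] [c1 ->]] := (gv _ hF0, gv _ hF1).
  exists (fun t => match split t with inl a => c0 a | inr a => c1 a end).
  rewrite big_split_ord /= !mulr_sumr; congr (_ + _); apply: eq_bigr => t _.
    by rewrite (unsplitK (inl t)) scalerAr.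
  by rewrite (unsplitK (inr t)) scalerAr.
exists 1%N, (fun=> 1); split=> [_|f /bihom00 ef]; first exact: bihom1.
by exists (fun=> f@_0); rewrite big_ord1 -mul_mpolyC mulr1.
Qed.

(** A generating family of least size is free, for a relation would allow one of
    its members to be discarded. *)
Lemma quotient_basis_exists I i j : is_ideal I ->
  exists n (v : 'I_n -> S), quotient_basis I i j v.
Proof.
move=> idI.
pose G n := exists v : 'I_n -> S, (forall t, biform i j (v t)) /\
  forall f, biform i j f -> exists c : 'I_n -> K, I (f - \sum_t c t *: v t).
have [n Gn] : exists n, `[< G n >].
  have [n [v [hv gv]]] := bihom_span false i j.
  exists n; apply/asboolP; exists v; split=> [t|f /(biformE false)/gv[c ->]].
    exact/(biformE false).
  by exists c; rewrite subrr; apply: ideal0.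
case: (ex_minnP (ex_intro (fun n => is_true `[< G n >]) n Gn)) => {n Gn}.
case=> [|n] /asboolP[v [hv gv]] mn; last first.
  exists n.+1, v; split=> // c Ic t; apply/eqP/negP => /negP ct0.
  suff /asboolP/mn : G n by rewrite ltnn.
  exists (fun a => v (lift t a)); split=> // f /gv[d Id].
  exists (fun a => d (lift t a) - d t / c t * c (lift t a)).
  rewrite -[X in I X](subrK (d t / c t *: \sum_a c a *: v a)).
  apply: idealD => //; last exact: idealZ.
  suff -> : f - \sum_(a < n) (d (lift t a) - d t / c t * c (lift t a)) *: v (lift t a)
      - (d t / c t) *: (\sum_(a < n.+1) c a *: v a) = f - \sum_a d a *: v a by [].
  rewrite !(bigD1_ord t) //= scalerDr scalerA divfK // scaler_sumr.
  under eq_bigr do rewrite scalerBl -scalerA.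
  by rewrite sumrB; ring.
by exists 0%N, v; split=> // c _ [].
Qed.

Lemma hilb_basis I i j : is_ideal I ->
  exists v : 'I_(hilb I i j) -> S, quotient_basis I i j v.
Proof.
move=> idI; have [n hn] := quotient_basis_exists i j idI.
exact: (xgetPex 0%N (ex_intro
  [set n | exists v : 'I_n -> S, quotient_basis I i j v] n hn)).
Qed.

End IdealTheory.

Lemma meval_exp (R : comNzRingType) n (v : 'I_n -> R) (f : {mpoly R[n]}) e :
  (f ^+ e).@[v] = f.@[v] ^+ e.
Proof. exact: rmorphXn. Qed.

(** * Forms in two variables and their roots *)

Section Roots.
Variable K : fieldType.
Local Notation S := (bipoly K).
Implicit Types (s : bool) (F c D : S) (P Q : quadric K).

Lemma root_factor s m P F : bihom s m.+1 0 F -> F.@[coord P] = 0 ->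
  exists F1, bihom s m 0 F1 /\ F = lin s (dir_pt s P) * F1.
Proof.
move=> /(lin_split (dir_pt s P))[F1 [F2 [-> h1 /bihom00 e2]]].
have /eqP lin0 : (lin s (dir_pt s P)).@[coord P] == 0 by rewrite lin_eq0.
rewrite e2 mevalD !mevalM meval_exp lin0 colin_at mevalC mul0r add0r expr1n mul1r.
by move=> ->; exists F1; rewrite mpolyC0 mulr0 addr0.
Qed.

Lemma root_const s F P : bihom s 0 0 F -> (F.@[coord P] == 0) = (F == 0).
Proof. by move=> /bihom00 ->; rewrite mevalC mpolyC_eq0. Qed.

(** Each root splits off a linear factor and lowers the degree. *)
Lemma finitely_many_roots s m F : bihom s m 0 F -> F != 0 ->
  exists r : seq K, forall t, t \notin r -> forall Q, dir_pt s Q = Some t ->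
    F.@[coord Q] != 0.
Proof.
elim: m F => [|m IHm] F hF F0.
  by exists [::] => t _ Q _; rewrite (root_const _ hF).
have [[t [P [Pt FP]]]|nz] :=
    pselect (exists t P, dir_pt s P = Some t /\ F.@[coord P] = 0); last first.
  by exists [::] => t _ Q Qt; apply/eqP => FQ; case: nz; exists t, Q.
have [F1 [h1 eF]] := root_factor hF FP.
have [|r hr] := IHm F1 h1.
  by apply: contraNneq F0 => e; rewrite eF e mulr0.
exists (t :: r) => t'; rewrite inE negb_or => /andP[t't t'r] Q Qt.
rewrite eF mevalM mulf_neq0 ?hr //; last by rewrite (hr t').
by rewrite lin_eq0 Qt Pt; apply: contraNneq t't => -[->].
Qed.

Lemma root_multiplicity s m P c F : bihom s 1 0 c -> c != 0 ->
  c.@[coord P] = 0 -> bihom s m 0 F -> F != 0 ->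
  exists n e D, [/\ bihom s e 0 D, D.@[coord P] != 0 & F = c ^+ n * D].
Proof.
move=> hc c0 cP.
have [k [hk ec]] := root_factor hc cP.
have ek := bihom00 hk.
have k0 : k@_0 != 0.
  by apply: contraNneq c0 => e; rewrite ec ek e mpolyC0 mulr0.
elim: m F => [|m IHm] F hF F0.
  by exists 0%N, 0%N, F; rewrite expr0 mul1r (root_const _ hF).
have [FP|FP] := eqVneq (F.@[coord P]) 0; last first.
  by exists 0%N, m.+1, F; rewrite expr0 mul1r.
have [F1 [h1 eF]] := root_factor hF FP.
have [||n [e [D [hD DP eD]]]] := IHm ((k@_0)^-1 *: F1); first exact: bihomZ.
  by rewrite scaler_eq0 invr_eq0 (negPf k0); apply: contraNneq F0 => e; rewrite eF e mulr0.
exists n.+1, e, D; split=> //.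
rewrite exprS -mulrA -eD ec {1}ek eF -!mul_mpolyC -mulrA; congr (_ * _).
by rewrite mulrA -mpolyCM divff // mpolyC1 mul1r.
Qed.

End Roots.

(** An algebraically closed field is infinite: a root of the product of the
    [X - x] times [X], plus 1, differs from every [x]. *)
Lemma closed_field_fresh (K : closedFieldType) (r : seq K) : exists t, t \notin r.
Proof.
pose p : {poly K} := \prod_(x <- r) ('X - x%:P) * 'X + 1.
have sp : size p = (size r).+2.
  have sq : size (\prod_(x <- r) ('X - x%:P) * 'X) = (size r).+2.
    by rewrite size_mulX ?size_prod_XsubC // monic_neq0 // monic_prod_XsubC.
  by rewrite size_polyDl sq // size_poly1.
have /closed_rootP[t /rootP pt] : size p != 1%N by rewrite sp.
exists t; apply/negP => tr; move: pt; rewrite /p hornerD hornerM hornerX hornerC.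
have /rootP -> : root (\prod_(x <- r) ('X - x%:P)) t by rewrite root_prod_XsubC.
by rewrite mul0r add0r => /eqP; rewrite oner_eq0.
Qed.

(** * Separators of arbitrary bidegree *)

Section Separators.
Variable K : closedFieldType.
Local Notation S := (bipoly K).
Implicit Types (s : bool) (f F L : S) (P Q : quadric K).
Variables (I : set S) (J : quadric K -> set S).
Hypotheses (hX : zero_dim_scheme I) (hJ : primary_decomposition I J).

Definition separates P : set S :=
  [set f | f.@[coord P] != 0 /\ (\bigcap_(Q in zeros I `\ P) J Q) f].

Definition avoids L := forall Q, zeros I Q -> L.@[coord Q] != 0.

Lemma scheme_ideal : is_ideal I. Proof. by case: hX. Qed.

Lemma comp_ideal Q : zeros I Q -> is_ideal (J Q).
Proof. by case: hJ => h _ /h[[]]. Qed.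

Lemma scheme_sub_comp Q f : zeros I Q -> I f -> J Q f.
Proof. by move=> ZQ; rewrite (proj2 hJ); apply. Qed.

Lemma in_scheme f : (forall Q, zeros I Q -> J Q f) -> I f.
Proof. by rewrite {2}(proj2 hJ). Qed.

Lemma point_ideal_root P f : point_ideal P f -> f.@[coord P] = 0.
Proof.
apply: (@ideal_gen_min _ _ [set f | f.@[coord P] = 0]); last by move=> x [].
split=> [|x y /= hx hy|d x /= hx]; first by rewrite /= meval0.
  by rewrite mevalD hx hy addr0.
by rewrite mevalM hx mulr0.
Qed.

(** The radical of the component at [Q] consists of polynomials vanishing at
    [Q], so it does not contain [L], and the component is primary. *)
Lemma comp_cancel Q L f : zeros I Q -> L.@[coord Q] != 0 -> J Q (L * f) -> J Q f.
Proof.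
move=> ZQ LQ; have [[_ _ pr] _ rad] := proj1 hJ Q ZQ.
rewrite mulrC => /pr[//|]; rewrite rad => /point_ideal_root LQ0.
by rewrite LQ0 eqxx in LQ.
Qed.

Lemma scheme_cancel L f : avoids L -> I (L * f) -> I f.
Proof.
move=> aL ILf; apply: in_scheme => Q ZQ; apply: (comp_cancel ZQ (aL Q ZQ)).
exact: scheme_sub_comp.
Qed.

Lemma avoidsX L n : avoids L -> avoids (L ^+ n).
Proof. by move=> h Q ZQ; rewrite meval_exp expf_neq0 ?h. Qed.

Lemma separatesMl P L F : L.@[coord P] != 0 -> separates P F -> separates P (L * F).
Proof.
move=> LP [FP hF]; split; first by rewrite mevalM mulf_neq0.
by move=> Q [ZQ QP]; apply: ideal_mull (comp_ideal ZQ) _ _ _; apply: hF.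
Qed.

Lemma separates_cancel P L f F : zeros I P -> avoids L -> separates P F ->
  I (F - L * f) -> separates P f.
Proof.
move=> ZP aL [FP hF] IFf; split.
  have /eqP := ZP _ IFf; rewrite mevalB mevalM subr_eq0 => /eqP e.
  by move: FP; rewrite e mulf_eq0 negb_or => /andP[].
move=> Q [ZQ QP]; apply: (comp_cancel ZQ (aL Q ZQ)).
rewrite -[L * f](subKr F); apply: idealB (comp_ideal ZQ) _ _ _ _; first exact: hF.
exact: scheme_sub_comp.
Qed.

(** The field being infinite, a general line of a ruling misses the finitely
    many points of the scheme, and finitely many further conditions. *)
Lemma generic_line s (r : seq K) : exists t, t \notin r /\ avoids (lin s (Some t)).
Proof.
have [_ _ _ /finite_seqP[pts eX]] := hX.
pose r' := pmap (fun Q : quadric K => dir_pt s Q : option K) pts.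
have [t] := closed_field_fresh (r ++ r').
rewrite mem_cat negb_or => /andP[tr tr']; exists t; split=> // Q.
rewrite eX /= => Qpts; rewrite lin_eq0; apply: contraNneq tr' => Qt.
by rewrite mem_pmap -Qt; apply: (map_f (fun Q : quadric K => dir_pt s Q : option K)).
Qed.

(** Each other point lies on a line that misses [P], and a power of its equation
    lies in the component at that point. *)
Lemma separates_exists s P : exists i j F, bihom s i j F /\ separates P F.
Proof.
have one Q : zeros I Q -> Q <> P ->
    exists i j g, [/\ bihom s i j g, g.@[coord P] != 0 & J Q g].
  move=> ZQ QP; have [d [i [j [hd dQ dP]]]] :
      exists (d : S) i j, [/\ bihom s i j d, d.@[coord Q] = 0 & d.@[coord P] != 0].
    have [e|e] := eqVneq (dir_pt s Q) (dir_pt s P); last first.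
      exists (lin s (dir_pt s Q)), 1%N, 0%N; split; first exact: bihom_lin.
        by apply/eqP; rewrite lin_eq0.
      by rewrite lin_eq0 eq_sym.
    exists (lin (~~ s) (dir_pt (~~ s) Q)), 0%N, 1%N; split.
    - exact/bihomC/bihom_lin.
    - by apply/eqP; rewrite lin_eq0.
    - rewrite lin_eq0; apply/eqP => e'; apply: QP.
      by move: e e'; rewrite /dir_pt; case: (s); case: (Q); case: (P) => ? ? ? ? /= -> ->.
  have [_ _ rad] := proj1 hJ Q ZQ.
  have [n Jdn] : radical (J Q) d.
    rewrite rad; apply: sub_ideal_gen; split=> //.
    by have := proj1 (biformE s i j d) hd; case: (s) => h; [exists j, i|exists i, j].
  exists (i * n)%N, (j * n)%N, (d ^+ n); split=> //; first exact: bihomX.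
  by rewrite meval_exp expf_neq0.
have [_ _ _ /finite_seqP[pts eX]] := hX.
suff [i [j [F [hF FP JF]]]] : exists i j F, [/\ bihom s i j F, F.@[coord P] != 0 &
    forall Q, Q \in pts -> zeros I Q -> Q <> P -> J Q F].
  by exists i, j, F; split=> //; split=> // Q [ZQ QP]; apply: JF => //; move: ZQ; rewrite eX.
elim: pts {eX} => [|Q pts [i [j [F [hF FP JF]]]]].
  exists 0%N, 0%N, 1; split=> //; first exact: bihom1.
  by rewrite meval1 oner_eq0.
have [[ZQ QP]|nQ] := pselect (zeros I Q /\ Q <> P); last first.
  by exists i, j, F; split=> // Q'; rewrite inE => /predU1P[->|/JF//] *; case: nQ.
have [i' [j' [g [hg gP Jg]]]] := one Q ZQ QP.
exists (i' + i)%N, (j' + j)%N, (g * F); split; first exact: bihomM.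
  by rewrite mevalM mulf_neq0.
move=> Q'; rewrite inE => /predU1P[->|Q'pts] ZQ' Q'P.
  exact: (ideal_mulr (comp_ideal ZQ) F Jg).




by apply: ideal_mull (comp_ideal ZQ') _ _ _; apply: JF.
Qed.

(** * Simple points *)

Lemma biform_nonvanishing P i j : exists g : S, biform i j g /\ g.@[coord P] != 0.
Proof.
exists (colin false (dir_pt false P) ^+ i * colin true (dir_pt true P) ^+ j); split.
  apply/(biformE false); rewrite -[i in bihom _ i]addn0 -[j in bihom _ _ j]add0n.
  apply: bihomM.
    by have := bihomX i (bihom_colin false (dir_pt false P)); rewrite mul1n mul0n.
  apply/bihomC.
  by have := bihomX j (bihom_colin true (dir_pt true P)); rewrite mul1n mul0n.
by rewrite mevalM !meval_exp !colin_at !expr1n mulr1 oner_eq0.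
Qed.

Lemma biformM i j i' j' f g : biform i j f -> biform i' j' g ->
  biform (i + i') (j + j') (f * g).
Proof. by move=> /(biformE false) hf /(biformE false) hg; apply/(biformE false)/bihomM. Qed.

Definition max_ideal P : set {fraction S} := [set z | exists i j (f g : S),
  [/\ biform i j f, f.@[coord P] = 0, biform i j g, g.@[coord P] != 0 &
      z = tofrac f / tofrac g]].

Lemma nonroot_tofrac P g : g.@[coord P] != 0 -> tofrac g != 0.
Proof. by rewrite tofrac_eq0; apply: contraNneq => ->; rewrite meval0. Qed.

Lemma max_ideal_local P : is_local_ideal P (max_ideal P).
Proof.
split.
- by move=> z [i [j [f [g [? ? ? ? ?]]]]]; exists i, j, f, g.
- exists 0%N, 0%N, 0, 1; split; rewrite ?meval0 ?meval1 ?oner_eq0 ?tofrac0 ?mul0r //.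
    exact/(biformE false)/bihom0.
  exact/(biformE false)/bihom1.
- move=> _ _ [i [j [f [g [hf fP hg gP ->]]]]] [i' [j' [f' [g' [hf' fP' hg' gP' ->]]]]].
  exists (i + i')%N, (j + j')%N, (f * g' + g * f'), (g * g'); split.
  + have /(biformE false) h1 := biformM hf hg'.
    have /(biformE false) h2 := biformM hg hf'.
    exact/(biformE false)/bihomD.
  + by rewrite mevalD !mevalM fP fP' mul0r mulr0 addr0.
  + exact: biformM.
  + by rewrite mevalM mulf_neq0.
  + have g0 := nonroot_tofrac gP; have g0' := nonroot_tofrac gP'.
    rewrite tofracD.
    rewrite (tofracM f g').
    rewrite (tofracM g f').
    rewrite (tofracM g g').
    rewrite (addf_div _ _ g0 g0').
    by rewrite (mulrC (tofrac g) (tofrac f')).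
- move=> _ _ [i [j [f [g [hf hg gP ->]]]]] [i' [j' [f' [g' [hf' fP' hg' gP' ->]]]]].
  exists (i + i')%N, (j + j')%N, (f * f'), (g * g'); split.
  + exact: biformM.
  + by rewrite mevalM fP' mulr0.
  + exact: biformM.
  + by rewrite mevalM mulf_neq0.
  + by rewrite !tofracM mulf_div.
Qed.

(** When the local ring of [X] at [P] has length one, the ideal of [X] becomes the
    maximal ideal there: otherwise the maximal ideal would refine the chain to
    length two. *)
Lemma simple_point P i j F : zeros I P -> has_length I P 1 -> biform i j F ->
  F.@[coord P] = 0 -> (\bigcap_(Q in zeros I `\ P) J Q) F -> I F.
Proof.
move=> ZP [[N [N0 N1 idN _]] maxlen] hF FP JF; apply: contrapT => nIF.
pose C t := if t is 0%N then local_ideal I P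
  else if t is 1%N then max_ideal P else local_ring P.
suff /maxlen : ideal_chain I P 2 C by [].
split=> //.
  case=> [|[|[|//]]] _ /=; [|exact: max_ideal_local|].
    by rewrite -N0; apply: idN.
  by rewrite -N1; apply: idN.
case=> [|[|//]] _ /=; split.
- move=> z [i' [j' [f [g [If hf hg gP ->]]]]].
  by exists i', j', f, g; split=> //; apply: ZP.
- move=> nsub; apply: nIF.
  have [g [hg gP]] := biform_nonvanishing P i j.
  have [|i' [j' [f' [g' [If' _ _ gP']]]]] := nsub (tofrac F / tofrac g).
    by exists i, j, F, g.
  have g0 := nonroot_tofrac gP; have g0' := nonroot_tofrac gP'.
  move/eqP; rewrite (eqr_div _ _ g0 g0') -(tofracM F g') -(tofracM f' g).
  rewrite tofrac_eq => /eqP e.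
  apply: in_scheme => Q ZQ; have [QP|QP] := pselect (Q = P); last by apply: JF.
  rewrite -QP in gP'; apply: (comp_cancel ZQ gP'); rewrite mulrC e.
  exact/scheme_sub_comp/(ideal_mulr scheme_ideal).
- by case: (max_ideal_local P).
- move=> nsub; have [|i' [j' [f [g [_ fP _ gP]]]]] := nsub 1.
    exists 0%N, 0%N, 1, 1; split; rewrite ?meval1 ?oner_eq0 ?divr1 ?tofrac1 ?invr1 ?mulr1 //;
      exact/(biformE false)/bihom1.
  move/esym/divr1_eq/eqP; rewrite tofrac_eq => /eqP e.
  by rewrite -e fP eqxx in gP.
Qed.

End Separators.

(** * Lowering the degree of a separator along one line *)

Section Line.
Variable K : closedFieldType.
Local Notation S := (bipoly K).
Implicit Types (f g h F G D W L : S) (P Q : quadric K).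
Variables (I : set S) (J : quadric K -> set S).
Hypotheses (hX : zero_dim_scheme I) (hJ : primary_decomposition I J).
Variables (s : bool) (t t' : K) (c : S) (q : nat).
Hypothesis (hc : bihom s 0 1 c).

Let l : S := lin s (Some t).
Let x : S := colin s (Some t).
Let y : S := lin (~~ s) (Some t').
Let y' : S := colin (~~ s) (Some t').

Let idI : is_ideal I := scheme_ideal hX.

Lemma bihom_lX n : bihom s n 0 (l ^+ n).
Proof. by have := bihomX n (bihom_lin s (Some t)); rewrite mul1n mul0n. Qed.

Lemma bihom_xX n : bihom s n 0 (x ^+ n).
Proof. by have := bihomX n (bihom_colin s (Some t)); rewrite mul1n mul0n. Qed.

Lemma bihom_yX n : bihom s 0 n (y ^+ n).
Proof.
by apply/bihomC; have := bihomX n (bihom_lin (~~ s) (Some t')); rewrite mul1n mul0n.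
Qed.

Lemma bihom_y'X n : bihom s 0 n (y' ^+ n).
Proof.
by apply/bihomC; have := bihomX n (bihom_colin (~~ s) (Some t')); rewrite mul1n mul0n.
Qed.

(** In a large bidegree (n, n) the quotient has dimension q + 1, so the q + 2 forms
    [l ^+ (n - r) * x ^+ r * y ^+ n] are dependent. The highest power of [x]
    occurring gives a monic equation, once the common power of [l] is factored
    out, which is harmless here: [l] and [y] may be inverted. *)
Lemma monic_equation_on_line : card_on_line I c q.+1 ->
  exists g A B, bihom s q 0 g /\
    ideal_gen (I `|` [set c]) (l ^+ A * y ^+ B * (x ^+ q.+1 - l * g)).
Proof.
move=> [N hN].
pose M := ideal_gen (I `|` [set c]).
have idM : is_ideal M := is_ideal_gen _.
(* The saturation of [M] with respect to [l * y] alone is visibly an ideal, and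
   contains the saturation with respect to the irrelevant ideal. *)
pose L' : set S := [set f | exists n, M ((l * y) ^+ n * f)].
have idL' : is_ideal L'.
  split=> [|f g [n hf] [m hg]|a f [n hf]].
  - by exists 0%N; rewrite mulr0; apply: ideal0.
  - exists (n + m)%N; rewrite exprD mulrDr; apply: (idealD idM).
      by rewrite mulrAC; apply: (ideal_mulr idM).
    by rewrite -mulrA; apply: (ideal_mull idM).
  - by exists n; rewrite mulrCA; apply: (ideal_mull idM).
have lyn n : biform n n ((l * y) ^+ n).
  have h : bihom s n n ((l * y) ^+ n).
    rewrite exprMn.
    by apply: (bihom_cast (bihomM (bihom_lX n) (bihom_yX n))); rewrite ?addn0.
  by have := proj1 (biformE _ _ _ _) h; case: (s).
pose n := (N + q.+1)%N.
have [v [_ _ gv]] : exists v : 'I_q.+1 -> S, quotient_basis (saturation M) n n v.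
  have := hN n n (leq_addr _ _) (leq_addr _ _).
  by rewrite /hilb; case: xgetP => [m _ [v hv] em|//]; subst m; exists v.
pose e (r : 'I_q.+2) : S := l ^+ (n - r) * x ^+ r * y ^+ n.
have he r : biform n n (e r).
  have h : bihom s n n (e r).
    apply: (bihom_cast (bihomM (bihomM (bihom_lX _) (bihom_xX _)) (bihom_yX _))).
      by have := ltn_ord r; rewrite /n; lia.
    by rewrite add0n.
  by have := proj1 (biformE _ _ _ _) h; case: (s).
have [d d0 [hd _]] : exists2 d : 'rV[K]_q.+2, d != 0 &
    L' (\sum_r d 0 r *: e r) /\ L' (\sum_r d 0 r *: 0).
  apply: (@ideal_dependence _ _ _ _ 0 v (fun=> 0)) => // [|r|r].
  - by rewrite addn0.
  - have [a [m ha]] := gv _ (he r); exists a, m; exact: ha.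
  - by exists (fun=> 0); rewrite big_ord0 subrr; apply: ideal0.
have [r0 dr0] : exists r0, d 0 r0 != 0 by apply/rV0Pn.
case: (@arg_maxnP _ r0 (fun r => d 0 r != 0) (fun r => r : nat) dr0) => tau dtau maxtau.
have tau_le : (tau <= q.+1)%N by rewrite -ltnS.
pose g : S := \sum_(r < q.+2) if (r < tau)%N then
  - (d 0 r / d 0 tau) *: (l ^+ (tau - r.+1) * x ^+ (q.+1 - tau + r)) else 0.
have hg : bihom s q 0 g.
  apply: bihom_sum => r; case: ifP => rtau; last exact: bihom0.
  apply: bihomZ.
  by apply: (bihom_cast (bihomM (bihom_lX _) (bihom_xX _))); lia.
have eg : x ^+ (q.+1 - tau) * (\sum_r d 0 r *: e r) =
    d 0 tau *: (l ^+ (n - tau) * y ^+ n * (x ^+ q.+1 - l * g)).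
  rewrite mulrBr scalerBr mulr_sumr (bigD1 tau) //=; congr (_ + _).
    rewrite /e -scalerAr; congr (_ *: _).
    have -> : x ^+ q.+1 = x ^+ (q.+1 - tau) * x ^+ tau by rewrite -exprD subnK.
    ring.
  rewrite /g [in RHS](bigD1 tau) //= ltnn add0r !mulr_sumr scaler_sumr -sumrN.
  apply: eq_bigr => r rtau; case: (ltngtP r tau) => [rlt|rgt|/val_inj req].
  - rewrite /e -!scalerAr scalerA -scaleNr; congr (_ *: _).
      by rewrite mulrN mulrCA divff // mulr1 opprK.
    have -> : (n - r = (n - tau) + (1 + (tau - r.+1)))%N by rewrite /n; lia.
    rewrite !exprD expr1; ring.
  - have /eqP -> : d 0 r == 0.
      by apply: contraTT rgt => /maxtau; rewrite -leqNgt.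
    by rewrite !scale0r !mulr0 scaler0 oppr0.
  - by rewrite req eqxx in rtau.
have [m hm] : L' (l ^+ (n - tau) * y ^+ n * (x ^+ q.+1 - l * g)).
  rewrite -[X in L' X]scale1r -(mulVf dtau) -scalerA -eg.
  exact/(idealZ idL')/(ideal_mull idL').
exists g, (m + (n - tau))%N, (m + n)%N; split=> //.
by move: hm; rewrite exprMn !exprD; congr M; ring.
Qed.

(** Division by the monic form [x ^+ q.+1 - l * g]: remainders have degree at most
    q in [x], which in homogeneous terms means divisible by [l ^+ i]. *)
Lemma monic_division g i j F : bihom s q 0 g -> bihom s (i + q) j F ->
  exists f W, F = l ^+ i * f + (x ^+ q.+1 - l * g) * W /\ bihom s q j f.
Proof.
move=> hg; elim: i F => [|i IHi] F hF.
  by exists F, 0; rewrite expr0 mul1r mulr0 addr0.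
have [F1 [F2 [-> h1 h2]]] := lin_split (Some t) hF.
have [|f [W [e1 hf]]] := IHi (F1 + x ^+ i * g * F2).
  apply: bihomD => //.
  by apply: (bihom_cast (bihomM (bihomM (bihom_xX i) hg) h2)); rewrite ?addn0.
exists f, (l * W + x ^+ i * F2); split=> //.
have -> : F1 = l ^+ i * f + (x ^+ q.+1 - l * g) * W - x ^+ i * g * F2.
  by rewrite -e1 addrK.
rewrite -/l -/x -addnS exprD [l ^+ i.+1]exprS; ring.
Qed.

(** Nakayama's lemma made explicit. The division replaces [F], up to powers of [l]
    and [y], by a form of degree q in [x] plus a multiple of [c], modulo the ideal;
    the factor [D], which completes a power of [c] to an element of the ideal,
    makes the process stop. *)
Lemma lower_degree_along_line : card_on_line I c q.+1 ->
  forall m D e, bihom s 0 e D -> I (c ^+ m * D) ->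
  forall i j F, bihom s (i + q) j F ->
  exists A B f, bihom s q (j + e + B) f /\
    I (l ^+ A * y ^+ B * (D * F) - l ^+ (A + i) * f).
Proof.
move=> /monic_equation_on_line[g [A [B [hg hmon]]]]; elim=> [|m IHm] D e hD IcD i j F hF.
  exists 0%N, 0%N, 0; split; first exact: bihom0.
  rewrite !expr0 mulr0 subr0 !mul1r; rewrite expr0 mul1r in IcD.
  exact: ideal_mulr.
have [f1 [W [eF hf1]]] := monic_division hg hF.
(* The extra factor [y] keeps the degree in [y] positive, so that [c] can be split
   off. *)
pose H := l ^+ A * y ^+ B.+1 * F - l ^+ (A + i) * y ^+ B.+1 * f1.
have hH : bihom s (i + A + q) (j + B).+1 H.
  apply: bihomB.
    by apply: (bihom_cast (bihomM (bihomM (bihom_lX _) (bihom_yX _)) hF)); lia.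
  by apply: (bihom_cast (bihomM (bihomM (bihom_lX _) (bihom_yX _)) hf1)); lia.
have genH : ideal_gen (I `|` [set c]) H.
  have -> : H = (y * W) * (l ^+ A * y ^+ B * (x ^+ q.+1 - l * g)).
    rewrite /H eF exprD [y ^+ B.+1]exprS; ring.
  exact: (ideal_mull (is_ideal_gen _) _ hmon).
have bhI : bihomogeneous I by case: hX.
have [h [hh IH]] := ideal_genU1_form idI bhI hc hH genH.
have hcD : bihom s 0 e.+1 (c * D) by apply: (bihom_cast (bihomM hc hD)); lia.
have [|A2 [B2 [f2 [hf2 If2]]]] := IHm _ _ hcD _ _ _ _ hh.
  by rewrite mulrA -exprSr.
exists (A2 + A)%N, (B2 + B.+1)%N, (y ^+ (B2 + B.+1) * D * f1 + f2); split.
  apply: bihomD; last by apply: (bihom_cast hf2); lia.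
  by apply: (bihom_cast (bihomM (bihomM (bihom_yX _) hD) hf1)); lia.
have := idealD idI (ideal_mull idI (l ^+ A2 * y ^+ B2 * D) IH) If2.
rewrite /H; congr I; rewrite !exprD; ring.
Qed.

Hypotheses (al : avoids I l) (ay : avoids I y).

(** As [y] does not divide [G], a power of [y'] times a unit is a multiple of [y]
    modulo [G]; beyond degree b a separator is therefore divisible by [y] modulo
    the ideal. *)
Lemma separator_descent P b G j f : zeros I P ->
  bihom s 0 b.+1 G -> I G ->
  (forall Q, dir_pt (~~ s) Q = Some t' -> G.@[coord Q] != 0) ->
  bihom s q (b + j) f -> separates I J P f ->
  exists f', bihom s q b f' /\ separates I J P f'.
Proof.
move=> ZP hG IG Gt'.
have /bihomC/(lin_split (Some t'))[G1 [G2 [eG hG1 /bihom00 eG2]]] := hG.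
pose Q : quadric K := (Some t', Some t').
have Qt' : dir_pt (~~ s) Q = Some t' by case: (~~ s).
pose k := G2@_0; have {}eG2 : G2 = k%:MP := eG2.
have k0 : k != 0.
  have := Gt' Q Qt'; have /eqP lQ : y.@[coord Q] == 0 by rewrite lin_eq0 Qt'.
  have := colin_at (~~ s) Q; rewrite Qt' => y'Q.
  by rewrite eG eG2 mevalD !mevalM meval_exp lQ y'Q mevalC mul0r add0r expr1n mul1r.
elim: j f => [|j IHj] f hf sf; first by exists f; rewrite addn0 in hf.
have /bihomC : bihom s q (b + j).+1 f by rewrite -addnS.
move=> /(lin_split (Some t'))[F1 [F2 [ef hF1 hF2]]].
apply: (IHj (F1 - k^-1 *: (y' ^+ j * F2 * G1))).
  apply/bihomC/bihomB => //; apply: bihomZ.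
  have hy' : bihom (~~ s) j 0 (y' ^+ j) by apply/bihomC; rewrite negbK; apply: bihom_y'X.
  by apply: (bihom_cast (bihomM (bihomM hy' hF2) hG1)); lia.
apply: (separates_cancel hJ ZP ay sf).
have -> : f - y * (F1 - k^-1 *: (y' ^+ j * F2 * G1)) =
    k^-1%:MP * (y' ^+ j * F2) * G.
  have kk : k^-1%:MP * k%:MP = 1 :> S by rewrite -mpolyCM mulVf ?mpolyC1.
  have ej : y' ^+ (b + j).+1 = y' ^+ b.+1 * y' ^+ j by rewrite -exprD addSn.
  rewrite ef eG -/y -/y' [in RHS]eG2 -mul_mpolyC ej.
  rewrite [in RHS]mulrDr.
  have -> : k^-1%:MP * (y' ^+ j * F2) * (y' ^+ b.+1 * k%:MP) =
     y' ^+ b.+1 * y' ^+ j * F2.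
    rewrite -[RHS]mul1r -kk; ring.
  ring.
exact: ideal_mull.
Qed.

Lemma separator_along_generic_lines P b G : zeros I P -> c != 0 -> c.@[coord P] = 0 ->
  card_on_line I c q.+1 ->
  bihom s 0 b.+1 G -> I G -> G != 0 ->
  (forall Q, dir_pt (~~ s) Q = Some t' -> G.@[coord Q] != 0) ->
  exists f, bihom s q b f /\ separates I J P f.
Proof.
move=> ZP c0 cP hcard hG IG G0 Gt'.
have [m [e [D [/bihomC hD DP eG]]]] : exists n e D,
    [/\ bihom (~~ s) e 0 D, D.@[coord P] != 0 & G = c ^+ n * D].
  exact: root_multiplicity (proj1 (bihomC _ _ _ _) hc) c0 cP
    (proj1 (bihomC _ _ _ _) hG) G0.
rewrite negbK in hD.
have [i [j [F [hF sF]]]] := separates_exists hX hJ s P.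
have hF' : bihom s (i + q) j (l ^+ q * F).
  by apply: (bihom_cast (bihomM (bihom_lX _) hF)); lia.
have sF' : separates I J P (l ^+ q * F).
  exact: (separatesMl hJ (avoidsX q al ZP) sF).
have IcD : I (c ^+ m * D) by rewrite -eG.
have [A [B [f [hf If]]]] := lower_degree_along_line hcard hD IcD hF'.
have sf : separates I J P f.
  apply: (separates_cancel hJ ZP (avoidsX (A + i) al) _ If).
  apply: (separatesMl hJ); last exact: (separatesMl hJ).
  by rewrite mevalM mulf_neq0 // meval_exp expf_neq0 // ?al ?ay.
have [bj|jb] := leqP b (j + e + B).
  by apply: (separator_descent (j := j + e + B - b) ZP hG IG Gt' _ sf); rewrite subnKC.
exists (y ^+ (b - (j + e + B)) * f); split.
  by apply: (bihom_cast (bihomM (bihom_yX _) hf)); lia.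
exact: (separatesMl hJ (avoidsX _ ay ZP) sf).
Qed.

End Line.

Lemma separator_along_line (K : closedFieldType) (I : set (bipoly K))
    (J : quadric K -> set (bipoly K)) (s : bool) (P : quadric K)
    (c G : bipoly K) (q b : nat) :
  zero_dim_scheme I -> primary_decomposition I J -> zeros I P ->
  bihom s 0 1 c -> c != 0 -> c.@[coord P] = 0 -> card_on_line I c q.+1 ->
  bihom s 0 b.+1 G -> I G -> G != 0 ->
  exists f, bihom s q b f /\ separates I J P f.
Proof.
move=> hX hJ ZP hc c0 cP hcard hG IG G0.
have [t [_ al]] := generic_line hX s [::].
have [r hr] := finitely_many_roots (proj1 (bihomC _ _ _ _) hG) G0.
have [t' [t'r ay]] := generic_line hX (~~ s) r.
exact: (separator_along_generic_lines hX hJ hc al ay ZP c0 cP hcard hG IG G0 (hr t' t'r)).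
Qed.

(** * A corner of the region of separator degrees *)

Section Corner.
Variable K : closedFieldType.
Local Notation S := (bipoly K).
Implicit Types (f g F L a b : S) (P Q : quadric K).
Variables (I : set S) (J : quadric K -> set S).
Hypotheses (hX : zero_dim_scheme I) (hJ : primary_decomposition I J).
Variable P : quadric K.
Hypotheses (ZP : zeros I P) (hm : has_length I P 1).

Let idI : is_ideal I := scheme_ideal hX.

(** The difference with the multiple having the same value at the simple point [P]
    vanishes on all of the scheme. *)
Lemma separator_spans i j f g : bihom false i j f -> separates I J P f ->
  bihom false i j g -> (\bigcap_(Q in zeros I `\ P) J Q) g ->
  exists th : K, I (g - th *: f).
Proof.
move=> hf [fP Jf] hg Jg; exists (g.@[coord P] / f.@[coord P]).
apply: (simple_point (i := i) (j := j) hX hJ ZP hm).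
- by apply/(biformE false)/bihomB => //; apply: bihomZ.
- by rewrite mevalB mevalZ divfK // subrr.
- move=> Q ZQ; have idQ := comp_ideal hJ (proj1 ZQ).
  by apply: (idealB idQ); [apply: Jg|apply: (idealZ idQ); apply: Jf].
Qed.

Lemma corner_relation u n l z f e : avoids I l ->
  bihom false 1 0 l -> bihom false 0 1 z ->
  bihom false u n.+1 f -> separates I J P f ->
  bihom false u.+1 n e -> separates I J P e ->
  exists th : K, I (z * e - th *: (l * f)).
Proof.
move=> al hl hz hf sf he [_ Je]; apply: (@separator_spans u.+1 n.+1).
- exact: bihomM hl hf.
- exact: (separatesMl hJ (al _ ZP) sf).
- exact: bihomM hz he.
- by move=> Q ZQ; apply: (ideal_mull (comp_ideal hJ (proj1 ZQ))); apply: Je.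
Qed.

Section Lines.
Variables (l y : S) (u n : nat).
Hypothesis al : avoids I l.
Hypotheses (hl : bihom false 1 0 l) (hy : bihom false 0 1 y).
Variables (f e : S).
Hypotheses (hf : bihom false u n.+1 f) (sf : separates I J P f).
Hypotheses (he : bihom false u.+1 n e) (se : separates I J P e).
Hypothesis no_sep : forall g, bihom false u n g -> ~ separates I J P g.

(** The lifts of a basis in the corner, the trivial syzygies [(y w, - l w)] and the
    pair [(- th f, e)] of [corner_relation] are independent in the sum of the two
    adjacent quotients. *)
Lemma corner_count :
  (forall F, bihom false u.+1 n.+1 F -> exists a b,
     [/\ bihom false u n.+1 a, bihom false u.+1 n b & I (F - (l * a + y * b))]) ->
  (hilb I u.+1 n.+1 + hilb I u n < hilb I u n.+1 + hilb I u.+1 n)%N.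
Proof.
move=> span.
have [v [hv fv _]] := hilb_basis u.+1 n.+1 idI.
have [w [hw fw _]] := hilb_basis u n idI.
have [v1 [_ _ gv1]] := hilb_basis u n.+1 idI.
have [v2 [_ _ gv2]] := hilb_basis u.+1 n idI.
have /fin_all_exists[a /fin_all_exists[b hab]] : forall r, exists a b,
    [/\ bihom false u n.+1 a, bihom false u.+1 n b & I (v r - (l * a + y * b))].
  by move=> r; apply: span; apply/(biformE false).
have [th hth] := corner_relation al hl hy hf sf he se.
rewrite ltnNge; apply/negP => le.
pose E1 (r : 'I_(hilb I u.+1 n.+1 + (hilb I u n + 1))) : S := match split r with
  | inl i => a i
  | inr r' => match split r' with inl k => y * w k | inr _ => - (th *: f) end end.
pose E2 (r : 'I_(hilb I u.+1 n.+1 + (hilb I u n + 1))) : S := match split r with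
  | inl i => b i
  | inr r' => match split r' with inl k => - (l * w k) | inr _ => e end end.
have hwk k : bihom false u n (w k) by apply/(biformE false).
have [|||d d0 [h1 h2]] := @ideal_dependence _ I _ _ _ v1 v2 E1 E2 idI.
- by rewrite addnA addn1 ltnS.
- move=> r; apply: gv1; apply/(biformE false); rewrite /E1.
  case: split => [i|r']; first by case: (hab i).
  case: split => [k|_]; first exact: bihomM hy (hwk k).
  exact/bihomN/bihomZ.
- move=> r; apply: gv2; apply/(biformE false); rewrite /E2.
  case: split => [i|r']; first by case: (hab i).
  case: split => [k|_] //; apply: bihomN; exact: bihomM hl (hwk k).
pose al' i := d 0 (lshift _ i).
pose be k := d 0 (rshift _ (lshift _ k)).
pose ga := d 0 (rshift _ (rshift _ ord0)).
have e1 : \sum_r d 0 r *: E1 r =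
    \sum_i al' i *: a i + (y * \sum_k be k *: w k - ga *: (th *: f)).
  rewrite big_split_ord /= big_split_ord /= big_ord1 mulr_sumr /E1.
  congr (_ + (_ + _)).
  - by apply: eq_bigr => i _; rewrite (unsplitK (inl i)).
  - apply: eq_bigr => k _; rewrite (unsplitK (inr (lshift _ k))).
    by rewrite (unsplitK (inl k)) scalerAr.
  - rewrite (unsplitK (inr (rshift _ ord0))) (unsplitK (inr ord0)).
    by rewrite scalerN.
have e2 : \sum_r d 0 r *: E2 r =
    \sum_i al' i *: b i + (ga *: e - l * \sum_k be k *: w k).
  rewrite big_split_ord /= big_split_ord /= big_ord1 mulr_sumr /E2.
  rewrite [ga *: e - _]addrC -sumrN; congr (_ + (_ + _)).
  - by apply: eq_bigr => i _; rewrite (unsplitK (inl i)).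
  - apply: eq_bigr => k _; rewrite (unsplitK (inr (lshift _ k))).
    by rewrite (unsplitK (inl k)) scalerN scalerAr.
  - by rewrite (unsplitK (inr (rshift _ ord0))) (unsplitK (inr ord0)).
rewrite {}e1 in h1; rewrite {}e2 in h2.
have al0 : forall i, al' i = 0.
  apply: fv.
  have h3 : I (\sum_i al' i *: (v i - (l * a i + y * b i))).
    by apply: (ideal_sum idI) => i; apply: (idealZ idI); case: (hab i).
  have := idealD idI (idealD idI h3 (ideal_mull idI l h1)) (ideal_mull idI y h2).
  move=> h4; have := idealB idI h4 (idealZ idI ga hth); congr I.
  under [\sum_i al' i *: (v i - _)]eq_bigr do rewrite scalerBr scalerDr !scalerAr.
  rewrite sumrB big_split /= -!mulr_sumr -!mul_mpolyC; ring.
have z1 : \sum_i al' i *: b i = 0 by apply: big1 => i _; rewrite al0 scale0r.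
rewrite z1 add0r in h2.
have ga0 : ga = 0.
  apply/eqP/negP => /negP ga0.
  apply: (@no_sep (ga^-1 *: \sum_k be k *: w k)).
    by apply/bihomZ/bihom_sum => k; apply: bihomZ.
  apply: (separates_cancel hJ ZP al se).
  by have := idealZ idI ga^-1 h2; rewrite scalerBr scalerK // scalerAr.
rewrite ga0 scale0r sub0r in h2.
have be0 : forall k, be k = 0.
  apply: fw; apply: (scheme_cancel hJ al).
  by have := idealN idI h2; rewrite opprK.
case/negP: d0; apply/eqP/rowP => r; rewrite mxE.
case: (splitP r) => [i ri|r' rr'].
  by rewrite -(al0 i); congr (d 0 _); apply: val_inj.
case: (splitP r') => [k rk|k rk].
  by rewrite -(be0 k); congr (d 0 _); apply: val_inj; rewrite /= rr' rk.
by rewrite -ga0; congr (d 0 _); apply: val_inj; rewrite /= rr' rk [k]ord1.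
Qed.

End Lines.

(** It remains to see that [l] and [y] generate the corner modulo the ideal. Modulo
    [l] and [y] only the multiples of [x ^+ u.+1 * y' ^+ n.+1] are left, and this
    form is proportional to [y' * e] when [y] is chosen not to divide the
    restriction [e2] of [e] to the line l = 0; but [y' * e] is itself a multiple
    of [l] modulo the ideal. *)
Lemma corner_drop u n f e :
  bihom false u n.+1 f -> separates I J P f ->
  bihom false u.+1 n e -> separates I J P e ->
  (forall g, bihom false u n g -> ~ separates I J P g) ->
  (hilb I u.+1 n.+1 + hilb I u n < hilb I u n.+1 + hilb I u.+1 n)%N.
Proof.
move=> hf sf he se no_sep.
have [t [_ al]] := generic_line hX false [::].
set l := lin false (Some t) in al.
have hl : bihom false 1 0 l := bihom_lin _ _.
pose x : S := colin false (Some t).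
have [e1 [e2 [ee he1 he2]]] := lin_split (Some t) he.
rewrite -/l -/x in ee.
have e20 : e2 != 0.
  apply/eqP => e20; apply: (no_sep _ he1); apply: (separates_cancel hJ ZP al se).
  by rewrite ee e20 mulr0 addr0 subrr; apply: ideal0.
have he2' : bihom true n 0 e2 := proj1 (bihomC _ _ _ _) he2.
have [r hr] := finitely_many_roots he2' e20.
have [t' t'r] := closed_field_fresh r.
pose y : S := lin true (Some t').
pose y' : S := colin true (Some t').
have hy : bihom false 0 1 y by apply/bihomC/bihom_lin.
have hy' : bihom false 0 1 y' by apply/bihomC/bihom_colin.
have hx : bihom false u.+1 0 (x ^+ u.+1).
  by apply: (bihom_cast (bihomX u.+1 (bihom_colin _ _))); lia.
have [e3 [e4 [ey he3 /bihom00 he4]]] :=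
  lin_split (Some t') (bihomM (bihom_colin true (Some t')) he2').
rewrite -/y -/y' in ey; pose k := e4@_0; have {}he4 : e4 = k%:MP := he4.
have k0 : k != 0.
  pose Q : quadric K := (Some t', Some t').
  have /eqP yQ : y.@[coord Q] == 0 by rewrite lin_eq0.
  have y'Q : y'.@[coord Q] = 1 by apply: (colin_at true Q).
  have := congr1 (meval (coord Q)) ey.
  rewrite he4 mevalD !mevalM meval_exp yQ y'Q mevalC mul0r add0r expr1n !mul1r.
  by move=> <-; apply: hr t'r _ _.
have [th hth] := corner_relation al hl hy' hf sf he se.
apply: (corner_count al hl hy hf sf he se no_sep) => F hF.
have [F1 [F2 [-> hF1 hF2]]] := lin_split (Some t) hF.
have [F3 [F4 [eF2 hF3 /bihom00 hF4]]] := lin_split (Some t') (proj1 (bihomC _ _ _ _) hF2).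
rewrite -/l -/x -/y -/y' in eF2 *; pose m := F4@_0; have {}hF4 : F4 = m%:MP := hF4.
exists (F1 - (m / k) *: (y' * e1) + (m / k * th) *: f),
  (x ^+ u.+1 * (F3 - (m / k) *: e3)); split.
- apply: bihomD; last exact: bihomZ.
  by apply: bihomB => //; apply: bihomZ; apply: (bihomM hy' he1).
- have h : bihom false 0 n (F3 - (m / k) *: e3).
    by apply/bihomC/bihomB => //; apply: bihomZ.
  by apply: (bihom_cast (bihomM hx h)); lia.
have := idealZ idI (m / k) hth; congr I.
rewrite eF2 hF4; have -> : m%:MP = (m / k)%:MP * k%:MP :> S by rewrite -mpolyCM divfK.
have -> : y' * e = l * (y' * e1) + x ^+ u.+1 * (y * e3 + y' ^+ n.+1 * k%:MP).
  rewrite ee -he4 -ey; ring.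
rewrite -!mul_mpolyC [(m / k * th)%:MP]mpolyCM; ring.
Qed.

End Corner.

Theorem theorem5 (K : closedFieldType)
  (I : set (bipoly K)) (hX : zero_dim_scheme I)
  (J : quadric K -> set (bipoly K)) (hJ : primary_decomposition I J)
  (a b : nat) (hab : Delta_size I a b)
  (R : 'I_a.+1 -> bipoly K) (hR : row_lines I R)
  (C : 'I_b.+1 -> bipoly K) (hC : col_lines I C)
  (h : 'I_a.+1) (k : 'I_b.+1) (P : quadric K)
  (hP : zeros [set R h] `&` zeros [set C k] = [set P])
  (hPX : zeros I P) (hm : has_length I P 1)
  (p q : nat)
  (hp : card_on_line I (R h) p.+1) (hq : card_on_line I (C k) q.+1)
  (hcond : p = b \/ q = a \/
    [/\ (p < b)%N, (q < a)%N
      & forall i j : int, (q.+1%:Z <= i)%R -> (p.+1%:Z <= j)%R ->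
          Delta_hilbert I i j = 0]) :
  exists f : bipoly K, separator I J P q p f.
Proof.
have [RP CP] : (R h).@[coord P] = 0 /\ (C k).@[coord P] = 0.
  have [hR0 hC0] : (zeros [set R h] `&` zeros [set C k]) P by rewrite hP.
  by split; [apply: hR0|apply: hC0].
have [[hRh Rh0] [hCk Ck0]] : (biform 1 0 (R h) /\ R h != 0) /\
    (biform 0 1 (C k) /\ C k != 0) by case: hR => /(_ h) ? _ _; case: hC => /(_ k).
have [[F [IF hF F0]] _ [G [IG hG G0]] _] := hab.
pose Sep i j := exists f, bihom false i j f /\ separates I J P f.
have sep_qb : Sep q b.
  apply: (separator_along_line hX hJ hPX (c := C k) (G := G)) => //.
    exact/(biformE false).
  exact/(biformE false).
have sep_ap : Sep a p.
  have [||f [hf sf]] := separator_along_line (s := true) (b := a) (q := p)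
    hX hJ hPX (c := R h) (G := F) _ Rh0 RP hp _ IF F0.
  - exact/(biformE true).
  - exact/(biformE true).
  by exists f; split=> //; apply/bihomC.
suff [f [hf [fP Jf]]] : Sep q p by exists f; split=> //; apply/(biformE false).
case: hcond => [->//|[->//|[pb qa D0]]].
have Sep_up i j i' j' : (i <= i')%N -> (j <= j')%N -> Sep i j -> Sep i' j'.
  move=> ii jj [f [hf sf]].
  have [g [hg gP]] := biform_nonvanishing P (i' - i) (j' - j).
  exists (g * f); split; last exact: (separatesMl hJ gP sf).
  have {}hg : bihom false (i' - i) (j' - j) g by apply/(biformE false).
  by apply: (bihom_cast (bihomM hg hf)); rewrite subnK.
apply: contrapT => nSep.
(* The corner: [n.+1] is the least degree in y of a separator of degree q in x,
   then [u.+1] is the least degree in x of a separator of degree [n] in y. *)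
have exn : exists n, `[< Sep q n >] by exists b; apply/asboolP.
case: (ex_minnP exn) => n /asboolP Sn minn.
have pn : (p < n)%N.
  by rewrite ltnNge; apply/negP => np; apply: nSep; apply: Sep_up Sn.
case: n pn Sn minn => // n pn Sn minn.
have exu : exists u, `[< Sep u n >].
  by exists a; apply/asboolP; apply: Sep_up sep_ap.
case: (ex_minnP exu) => u /asboolP Su minu.
have qu : (q < u)%N.
  rewrite ltnNge; apply/negP => uq.
  have /minn : `[< Sep q n >] by apply/asboolP; apply: Sep_up Su.
  by rewrite ltnn.
case: u qu Su minu => // u qu [e [he se]] minu.
have [f [hf sf]] : Sep u n.+1 by apply: Sep_up Sn.
have no_sep g : bihom false u n g -> ~ separates I J P g.
  move=> hg sg; have /minu : `[< Sep u n >] by apply/asboolP; exists g.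
  by rewrite ltnn.
have drop := corner_drop hX hJ hPX hm hf sf he se no_sep.
have := D0 u.+1 n.+1; rewrite !lez_nat => /(_ qu pn).
rewrite /Delta_hilbert.
have -> : (u.+1%:Z - 1 = u)%R by rewrite -addn1 PoszD addrK.
have -> : (n.+1%:Z - 1 = n)%R by rewrite -addn1 PoszD addrK.
rewrite /=; lia.
Qed.
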